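(* Let $D,E$ be operators, $\langle W|$ a row vector and $|V\rangle$ a column vector satisfying $$DE-qED=D+E,\qquad \langle W|E=\langle W|,\qquad D|V\rangle=|V\rangle,\qquad \langle W|V\rangle=1 .$$ Then for every integer $n>0$, $$ \langle W|(D+E)^{n-1}|V\rangle = \frac 1{(1-q)^n} \sum_{k=0}^n (-1)^k \left( \binom{2n}{n-k} - \binom{2n}{n-k-2} \right) \left( \sum_{i=0}^k q^{i(k+1-i)} \right). $$
   Context: $q$ is an indeterminate (scalar). $D,E$ are linear operators on a vector space over a field containing $\mathbb{Q}(q)$ (for instance, suitable infinite matrices), $|V\rangle$ is a vector of that space, and $\langle W|$ is a linear functional on it; $\langle W|X|V\rangle$ denotes the resulting scalar. Binomial coefficients $\binom{n}{k}$ with $n\ge 0$ are $0$ unless $0\le k\le n$. *)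

(* Defs.v *)
From mathcomp Require Import all_boot all_order all_algebra.

Set Implicit Arguments.
Unset Strict Implicit.
Unset Printing Implicit Defensive.

Import GRing.Theory.
Local Open Scope ring_scope.

(* The lower index ranges over int because n - k - 2 may be negative, where
   truncated subtraction would give 'C(n, 0) = 1 instead of 0. *)
Definition binz (n : nat) (k : int) : nat :=
  if k is Posz m then 'C(n, m) else 0%N.

Definition Qq : fieldType := {fraction {poly rat}}.

Definition Qq_var : Qq := tofrac ('X : {poly rat}).

(* Main.v *)
Require Import Defs.
From mathcomp Require Import all_boot all_order all_algebra.
From mathcomp Require Import ring zify.

Set Implicit Arguments.
Unset Strict Implicit.
Unset Printing Implicit Defensive.

Import Order.TTheory GRing.Theory Num.Theory.
Local Open Scope ring_scope.

(** Put d = 1 - (1 - q) D, e = 1 - (1 - q) E and T = d + e.  The hypotheses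
    become the q-oscillator relation d e - q e d = 1 - q together with
    <W| e = q <W| and d |V> = q |V>, and (1 - q) (D + E) = 2 - T.  So the
    theorem evaluates the functional p |-> <W| p(T) |V> on powers of 2 - T, and
    two families of polynomials do the work.

    - Chebyshev polynomials U_k, with U_(k+1) = T U_k - U_(k-1).  Writing
      T = x + 1/x, one has (2 - T)^N = (-1)^N (x^(1/2) - x^(-1/2))^(2N), so the
      coefficient of U_k in (2 - T)^N is, up to the sign (-1)^k, the ballot
      number binom(2N, N-k) - binom(2N, N-k-2) (ballot_sumS).
    - Continuous q-Hermite polynomials, H_n = sum_j [n, j] U_(n-2j), where
      U_(-2-k) = - U_k and [n, j] is the Gaussian binomial.  They satisfy
      T H_n = H_(n+1) + (1 - q^n) H_(n-1) (hermite_rec).  Normal ordering turns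
      H_n(T) into sum_j [n, j] e^j d^(n-j), whence
      <W| H_n(T) |V> = q^n sum_j [n, j] (hermite_chebyshev).

    Let A_k = sum_i q^(i (k+1-i)) be the inner sum of the theorem.  Formally
    it is <W'| U_k(T) |V> for a functional with <W'| E = 0 and <W'| D = <W|;
    on that functional e acts as 1, so it should send H_n to
    sum_s [n, s] q^s, and it should satisfy
    <W'| (2 - T) p(T) |V> = (1 - q) <W| p(T) |V>.  No such W' need exist on the
    given space, so the first expectation is proved as an identity on the
    numbers A_k (hermite_moment), and the second is then checked on the basis
    H_n (hermite_moment_neighbours) and transferred to U_k, the change of basis
    being unitriangular (hermite_eq0).  This gives
    (1 - q) <W| U_k(T) |V> = 2 A_k - A_(k+1) - A_(k-1) (W_chebyshev).

    Finally, the ballot expansion of (2 - T)^(n-1), applied to the sequence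
    2 A_k - A_(k+1) - A_(k-1), is the ballot expansion with n in place of
    n - 1 applied to A_k, which is the right-hand side of the theorem. *)

(** * Gaussian binomials and sums weighted by them *)

Section QBinomial.
Variables (K : comNzRingType) (q : K).

Fixpoint qbin (n k : nat) : K :=
  match n, k with
  | _, 0 => 1
  | 0, _.+1 => 0
  | n'.+1, k'.+1 => qbin n' k' + q ^+ k * qbin n' k
  end.

Lemma qbinn0 n : qbin n 0 = 1.
Proof. by case: n. Qed.

Lemma qbinSS n k :
  qbin n.+1 k.+1 = qbin n k + q ^+ k.+1 * qbin n k.+1.
Proof. by []. Qed.

Lemma qbin_small n k : (n < k)%N -> qbin n k = 0.
Proof.
elim: n k => [|n IHn] [|k] //= ltnk.
by rewrite !IHn ?mulr0 ?addr0 //; lia.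
Qed.

Lemma qbinnn n : qbin n n = 1.
Proof. by elim: n => //= n ->; rewrite qbin_small // mulr0 addr0. Qed.

(** The quotient of two adjacent Gaussian binomials, cross-multiplied so that no
    condition on q is needed. *)
Lemma qbin_absorb_col n k : (k <= n)%N ->
  (1 - q ^+ k.+1) * qbin n k.+1 = (1 - q ^+ (n - k)) * qbin n k.
Proof.
elim: n k => [|n IHn] [|k] // lekn; first by rewrite /= subnn expr0; ring.
- rewrite qbinSS !qbinn0 mulrDr mulr1 mulrCA IHn //.
  rewrite !subn0 qbinn0 [q ^+ n.+1]exprS.
  by ring.
have [ltkn|ltnk] := leqP k.+1 n; last first.
  rewrite qbin_small; last by lia.
  have -> : k.+1 = n.+1 by lia.
  by rewrite subnn expr0; ring.
have Hk := IHn k (ltnW ltkn); have Hk1 := IHn k.+1 ltkn.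
rewrite !(qbinSS n) mulrDr mulrCA Hk1 subSS.
rewrite [RHS]mulrDr -Hk.
have -> : (n - k = (n - k.+1).+1)%N by lia.
by rewrite !exprS; ring.
Qed.

Lemma qbin_absorb n k :
  (1 - q ^+ k.+1) * qbin n.+1 k.+1 = (1 - q ^+ n.+1) * qbin n k.
Proof.
have [lekn|ltnk] := leqP k n; last by rewrite !qbin_small // !mulr0.
rewrite qbinSS mulrDr mulrCA qbin_absorb_col //.
by rewrite mulrA -mulrDl mulrBr mulr1 -exprD addSn subnKC // subrKA.
Qed.

Lemma qbinSSr n k : (k <= n)%N ->
  qbin n.+1 k.+1 = q ^+ (n - k) * qbin n k + qbin n k.+1.
Proof.
move=> lekn; rewrite qbinSS; apply/eqP; rewrite -subr_eq0; apply/eqP.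
transitivity ((1 - q ^+ (n - k)) * qbin n k - (1 - q ^+ k.+1) * qbin n k.+1).
  by ring.
by rewrite qbin_absorb_col // subrr.
Qed.

Lemma qbin_sub n k : (k <= n)%N -> qbin n (n - k) = qbin n k.
Proof.
elim: n k => [|n IHn] [|k] // lekn; first by rewrite subn0 qbinnn qbinn0.
have [->|ltkn] := eqVneq k n; first by rewrite subnn qbinnn.
have -> : (n.+1 - k.+1 = (n - k.+1).+1)%N by lia.
rewrite qbinSSr ?leq_subr // qbinSS IHn; last by lia.
have -> : (n - (n - k.+1) = k.+1)%N by lia.
have -> : (n - k.+1).+1 = (n - k)%N by lia.
by rewrite IHn // addrC.
Qed.

Section QSum.
Variable U : lmodType K.
Implicit Type f : nat -> U.

Definition qsum n f := \sum_(j < n.+1) qbin n j *: f j.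

Lemma eq_qsum n f g :
  (forall j, (j <= n)%N -> f j = g j) -> qsum n f = qsum n g.
Proof. by move=> fg; apply: eq_bigr => j _; rewrite fg // -ltnS. Qed.

Lemma qsumD n f g : qsum n (fun j => f j + g j) = qsum n f + qsum n g.
Proof. by rewrite -big_split; apply: eq_bigr => j _; rewrite scalerDr. Qed.

Lemma qsumZ n c f : qsum n (fun j => c *: f j) = c *: qsum n f.
Proof.
by rewrite scaler_sumr; apply: eq_bigr => j _; rewrite !scalerA mulrC.
Qed.

Lemma qsumB n f g : qsum n (fun j => f j - g j) = qsum n f - qsum n g.
Proof.
by rewrite -scaleN1r -qsumZ -qsumD; apply: eq_qsum => j _; rewrite scaleN1r.
Qed.

Lemma qsum0 f : qsum 0 f = f 0%N.
Proof. by rewrite /qsum big_ord_recl big_ord0 addr0 scale1r. Qed.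

Lemma qsum_rev n f : qsum n f = qsum n (fun j => f (n - j)%N).
Proof.
rewrite /qsum (reindex_inj rev_ord_inj); apply: eq_bigr => j _ /=.
by rewrite subSS qbin_sub // -ltnS.
Qed.

(** Pascal's rule, with the shift of the summation index moved onto [f]. *)
Lemma qsum_pascal n f :
  qsum n.+1 f = qsum n (fun j => f j.+1 + q ^+ j *: f j).
Proof.
rewrite qsumD /qsum big_ord_recl qbinn0 scale1r.
under eq_bigr do rewrite lift0 qbinSS scalerDl.
rewrite big_split addrCA; congr (_ + _).
rewrite [X in _ + X]big_ord_recr /= (@qbin_small n n.+1) // mulr0 scale0r addr0.
rewrite [RHS]big_ord_recl qbinn0 expr0 !scale1r; congr (_ + _).
by apply: eq_bigr => j _; rewrite lift0 scalerA mulrC.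
Qed.

Lemma qsum_absorb n f :
  (1 - q ^+ n.+1) *: qsum n (fun j => f j.+1)
  = qsum n.+1 (fun j => (1 - q ^+ j) *: f j).
Proof.
rewrite /qsum [RHS]big_ord_recl expr0 subrr scale0r scaler0 add0r scaler_sumr.
by apply: eq_bigr => j _; rewrite !lift0 !scalerA -qbin_absorb mulrC.
Qed.

(** The three-term recurrence of the q-Hermite polynomials, for the
    coefficients alone: the term q^j of Pascal's rule and the term 1 - q^j of
    absorption cancel. *)
Lemma qsum_hermite n f :
  qsum n.+2 f + (1 - q ^+ n.+1) *: qsum n (fun j => f j.+1)
  = qsum n.+1 (fun j => f j + f j.+1).
Proof.
rewrite qsum_pascal qsum_absorb -qsumD; apply: eq_qsum => j _.
by rewrite -addrA -scalerDl addrC subrKC scale1r addrC.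
Qed.

End QSum.
End QBinomial.

(** * From Chebyshev to q-Hermite coordinates *)

Section Reflection.
Variables (K : comNzRingType) (q : K) (U : lmodType K).
Implicit Type a : nat -> U.

(** The odd extension about -1, forced on Chebyshev polynomials by
    U_(-1) = 0 and their recurrence.  With it the sum defining [hermite] below
    runs over all of 0..n with no boundary term. *)
Definition reflect_seq a (m : int) : U :=
  match m with
  | Posz k => a k
  | Negz 0 => 0
  | Negz k.+1 => - a k
  end.

(** Multiplication by T, read on the values that a linear functional takes on
    the Chebyshev polynomials. *)
Definition neighbours a k := a k.+1 + (if k is k'.+1 then a k' else 0).

Lemma reflect_neighbours a m :
  reflect_seq (neighbours a) m = reflect_seq a (m + 1) + reflect_seq a (m - 1).
Proof.
case: m => [[|k]|[|[|k]]].
- by [].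
- have -> : (k.+1%:Z + 1) = k.+2%:Z by lia.
  by have -> : (k.+1%:Z - 1) = k%:Z by lia.
- by rewrite /= subrr.
- by rewrite /= /neighbours addr0 add0r.
- have -> : (Negz k.+2 + 1) = Negz k.+1 by lia.
  have -> : (Negz k.+2 - 1) = Negz k.+3 by lia.
  by rewrite /= opprD addrC.
Qed.

(** If a k is the value at U_k of a linear map defined on polynomials, this is
    its value at the q-Hermite polynomial H_n. *)
Definition hermite a n : U :=
  qsum q n (fun j => reflect_seq a (n%:Z - 2 * j%:Z)).

Lemma hermite0 a : hermite a 0 = a 0%N.
Proof. by rewrite /hermite qsum0. Qed.

Lemma hermite1 a : hermite a 1 = a 1%N.
Proof.
by rewrite /hermite qsum_pascal qsum0 /= add0r expr0 scale1r.
Qed.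

Lemma hermite_rec a n :
  hermite a n.+2 + (1 - q ^+ n.+1) *: hermite a n = hermite (neighbours a) n.+1.
Proof.
rewrite /hermite; set f := fun j : nat => reflect_seq a (n.+2%:Z - 2 * j%:Z).
have -> : qsum q n (fun j => reflect_seq a (n%:Z - 2 * j%:Z))
          = qsum q n (fun j => f j.+1).
  by apply: eq_qsum => j _; congr reflect_seq; lia.
rewrite qsum_hermite; apply: eq_qsum => j _.
by rewrite reflect_neighbours; congr (reflect_seq a _ + reflect_seq a _); lia.
Qed.

(** The transform is unitriangular: for 0 < j <= n the index n - 2j lies between
    -n and n - 2, where the odd extension only takes values of a before n. *)
Lemma hermite_eq0 a : (forall n, hermite a n = 0) -> forall k, a k = 0.
Proof.
move=> Ra k; elim/ltn_ind: k => k IHk.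
have := Ra k; rewrite /hermite /qsum big_ord_recl qbinn0 scale1r mulr0 subr0.
rewrite big1 ?addr0 // => j _; rewrite lift0.
suff -> : reflect_seq a (k%:Z - 2 * j.+1%:Z) = 0 by rewrite scaler0.
have := ltn_ord j.
case E: (k%:Z - 2 * j.+1%:Z) => [l|[|l]] //= ltjk; rewrite IHk ?oppr0 //; lia.
Qed.

End Reflection.

(** * The inner sums, in q-Hermite coordinates *)

Section Moments.
Variables (K : fieldType) (q : K).
Hypothesis q_neq0 : q != 0.

Definition moment (k : nat) : K^o := \sum_(i < k.+1) q ^+ (i * (k + 1 - i)).

(** The generic term of [moment (x + y)], extended to integer x and y: the sign
    factor is 1 when both indices are nonnegative, -1 when both are negative and
    0 otherwise.  Summed over a line x + y = m it yields the odd extension of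
    [moment] (lemma [sum_signed_term]), because (x, y) |-> (-1-y, -1-x)
    preserves the exponent. *)
Definition signed_term (x y : int) : K :=
  ((0 <= x)%R%:R + (0 <= y)%R%:R - 1) * q ^ (x * (y + 1)).

(** The exponents at (x, y) and (x - 1, y + 1) differ by y - x + 2, and the
    signs differ only on the two lines x = 0 and y = -1, where the exponent
    vanishes. *)
Lemma signed_term_shift x y :
  signed_term x y = q ^ (y - x + 2) * signed_term (x - 1) (y + 1)
    + ((x == 0)%R%:R - (y == -1)%R%:R).
Proof.
rewrite /signed_term mulrCA -expfzDr //.
have -> : y - x + 2 + (x - 1) * (y + 1 + 1) = x * (y + 1) by ring.
have step (z : int) : (0 <= z + 1) = (z == -1) || (0 <= z) by lia.
have stepx : (0 <= x) = (x == 0) || (0 <= x - 1) by lia.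
rewrite step stepx; have [->|xN0] := eqVneq x 0; have [->|yN1] := eqVneq y (-1).
- by rewrite mul0r expr0z /=; ring.
- by rewrite mul0r expr0z /=; ring.
- by rewrite addNr mulr0 expr0z /=; ring.
- by rewrite /=; ring.
Qed.

Lemma qsum_indicator (n k : nat) : (k <= n)%N ->
  qsum q n (fun j => (j == k)%:R : K^o) = qbin q n k.
Proof.
rewrite -ltnS => ltkn; rewrite /qsum (bigD1 (Ordinal ltkn)) //= eqxx.
rewrite big1 ?addr0 => [|j jNk]; first exact: mulr1.
by rewrite -[_ == k]/(j == Ordinal ltkn) (negPf jNk) scaler0.
Qed.

(** This is the coefficient of z^(n-2s) in the Laurent polynomial identity
    sum_j [n, j] A_(n-2j)(z) = sum_s [n, s] (q/z)^s z^(n-s), where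
    A_k(z) = sum_i q^(i (k+1-i)) z^(k-2i) for k >= 0 and A_(-2-k) = - A_k.
    Both sides satisfy the same first-order q-difference equation in z, which
    for the coefficients is an induction on s: each boundary line of
    [signed_term_shift] contributes one Gaussian binomial. *)
Lemma qsum_signed_term n s : (s <= n)%N ->
  qsum q n (fun j => signed_term (s%:Z - j%:Z) (n%:Z - s%:Z - j%:Z) : K^o)
  = qbin q n s * q ^+ s.
Proof.
elim: s => [|s IHs] lesn.
  rewrite qbinn0 mulr1 -(qbinn0 q n) -qsum_indicator //.
  apply: eq_qsum => -[|j] lejn.
    rewrite /signed_term /= !subr0 mul0r expr0z.
    by case: n {lejn lesn} => [|n] /=; ring.
  rewrite /signed_term.
  have -> : (0 <= 0%:Z - j.+1%:Z) = false by lia.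
  have -> : (0 <= n%:Z - 0%:Z - j.+1%:Z) = true by lia.
  by rewrite /=; ring.
pose f (j : nat) : K^o := signed_term (s%:Z - j%:Z) (n%:Z - s%:Z - j%:Z).
pose g (j : nat) : K^o := (j == s.+1)%:R - (j == (n - s)%N)%:R.
transitivity (qsum q n (fun j => q ^ (n%:Z - 2 * s%:Z) *: f j + g j)).
  apply: eq_qsum => j lejn; rewrite signed_term_shift /f /g.
  congr (_ ^ _ * signed_term _ _ + (_%:R - _%:R)); lia.
rewrite qsumD qsumZ IHs ?(ltnW lesn) // qsumB !qsum_indicator ?leq_subr //.
rewrite qbin_sub ?(ltnW lesn) // [_ *: _]mulrCA.
have -> : q ^ (n%:Z - 2 * s%:Z) * q ^+ s = q ^+ (n - s).
  by rewrite [q ^+ s]exprnP [RHS]exprnP -expfzDr //; congr (_ ^ _); lia.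
have := qbin_absorb_col q (ltnW lesn); rewrite mulrBl mul1r => E.
have {}E : q ^+ s.+1 * qbin q n s.+1
  = qbin q n s.+1 - (1 - q ^+ (n - s)) * qbin q n s by rewrite -E; ring.
by rewrite [RHS]mulrC E; ring.
Qed.

Lemma sum_signed_term (j n : nat) : (j <= n)%N ->
  \sum_(s < n.+1) signed_term (s%:Z - j%:Z) (n%:Z - s%:Z - j%:Z)
  = reflect_seq moment (n%:Z - 2 * j%:Z).
Proof.
move=> lejn.
set f := fun s : nat => signed_term (s%:Z - j%:Z) (n%:Z - s%:Z - j%:Z).
have f0 s : (0 <= s%:Z - j%:Z) != (0 <= n%:Z - s%:Z - j%:Z) -> f s = 0.
  rewrite /f /signed_term.
  case: (0 <= s%:Z - j%:Z); case: (0 <= n%:Z - _ - _) => //= _.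
    by rewrite addr0 subrr mul0r.
  by rewrite add0r subrr mul0r.
have sum0 a b : (forall s, (a <= s < b)%N ->
    (0 <= s%:Z - j%:Z) != (0 <= n%:Z - s%:Z - j%:Z)) ->
    \sum_(a <= s < b) f s = 0.
  by move=> ab0; rewrite big_nat big1 // => s /ab0 /f0.
rewrite -(big_mkord xpredT f).
(* Only the s between j and n - j, or strictly between n - j and j when
   n - j < j, give both indices the same sign. *)
case E: (n%:Z - 2 * j%:Z) => [k|[|k]].
- rewrite (big_cat_nat (n := j)) //=; last by lia.
  rewrite (big_cat_nat (m := j) (n := (k.+1 + j)%N)) /=; [|lia|lia].
  rewrite sum0 ?add0r; last by lia.
  rewrite [X in _ + X]sum0 ?addr0; last by lia.
  rewrite -{1}[j]add0n big_addn addnK big_mkord; apply: eq_bigr => i _.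
  rewrite /f /signed_term.
  have -> : (0 <= (i + j)%:Z - j%:Z) = true by lia.
  have -> : (0 <= n%:Z - (i + j)%:Z - j%:Z) = true by have := ltn_ord i; lia.
  have -> : (i + j)%:Z - j%:Z = i by lia.
  have -> : n%:Z - (i + j)%:Z - j%:Z + 1 = (k + 1 - i)%N.
    by have := ltn_ord i; lia.
  by rewrite -PoszM addrK mul1r.
- by apply: sum0; lia.
rewrite (big_cat_nat (n := j - k.+1)) /=; [|lia|lia].
rewrite (big_cat_nat (m := j - k.+1) (n := j)) /=; [|lia|lia].
rewrite sum0 ?add0r; last by lia.
rewrite [X in _ + X]sum0 ?addr0; last by lia.
have {1}-> : (j - k.+1 = 0 + (j - k.+1))%N by [].
rewrite big_addn subKn; last by lia.
rewrite big_mkord -sumrN; apply: eq_bigr => i _.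
have := ltn_ord i; rewrite /f /signed_term => lti.
have -> : (0 <= (i + (j - k.+1))%:Z - j%:Z) = false by lia.
have -> : (0 <= n%:Z - (i + (j - k.+1))%:Z - j%:Z) = false by lia.
have -> : (i + (j - k.+1))%:Z - j%:Z = - (k + 1 - i)%N%:Z by lia.
have -> : n%:Z - (i + (j - k.+1))%:Z - j%:Z + 1 = - i%:Z by lia.
by rewrite mulrNN -PoszM mulnC addr0 sub0r mulN1r.
Qed.

(** Exchange the summations: for fixed j the terms with x = s - j and
    y = n - s - j fill the line x + y = n - 2j. *)
Lemma hermite_moment n :
  hermite q moment n = qsum q n (fun s => q ^+ s : K^o).
Proof.
rewrite /hermite.
transitivity (\sum_(s < n.+1) qsum q n
  (fun j => signed_term (s%:Z - j%:Z) (n%:Z - s%:Z - j%:Z) : K^o)).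
  rewrite exchange_big; apply: eq_bigr => j _.
  by rewrite -scaler_sumr sum_signed_term // -ltnS.
by apply: eq_bigr => s _; rewrite qsum_signed_term // -ltnS.
Qed.

End Moments.

(** * The ballot expansion of powers of 2 - T *)

Section Ballot.

Lemma binz_pascal n m : binz n.+1 m = (binz n m + binz n (m - 1))%N.
Proof.
case: m => [[|m]|m] //; first by rewrite /= !bin0.
by have -> : (m.+1%:Z - 1 = m)%R by lia.
Qed.

Variable (K : comNzRingType).

Definition ballot (n : nat) (k : int) : K :=
  (binz (2 * n) (n%:Z - k))%:R - (binz (2 * n) (n%:Z - k - 2))%:R.

(** A ballot number is a difference of central binomials; each of these obeys
    Pascal's rule applied twice, which is multiplication by
    (x^(1/2) + x^(-1/2))^2 = x + 2 + 1/x. *)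
Lemma ballotS n k :
  ballot n.+1 k = ballot n k *+ 2 + ballot n (k - 1) + ballot n (k + 1).
Proof.
have binzS m : ((binz (2 * n.+1) (n.+1%:Z - m))%:R : K)
    = (binz (2 * n) (n%:Z - m))%:R *+ 2 + (binz (2 * n) (n%:Z - (m - 1)))%:R
      + (binz (2 * n) (n%:Z - (m + 1)))%:R.
  have -> : (2 * n.+1 = (2 * n).+2)%N by lia.
  rewrite !binz_pascal !natrD.
  have -> : n.+1%:Z - m = n%:Z - (m - 1) by lia.
  have -> : n%:Z - (m - 1) - 1 = n%:Z - m by lia.
  have -> : n%:Z - m - 1 = n%:Z - (m + 1) by lia.
  by ring.
rewrite /ballot.
have -> : n.+1%:Z - k - 2 = n.+1%:Z - (k + 2) by lia.
rewrite !binzS.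
have -> : n%:Z - k - 2 = n%:Z - (k + 2) by lia.
have -> : n%:Z - (k - 1) - 2 = n%:Z - (k + 2 - 1) by lia.
have -> : n%:Z - (k + 1) - 2 = n%:Z - (k + 2 + 1) by lia.
by ring.
Qed.

Lemma ballot_small (n k : nat) : (n < k)%N -> ballot n k = 0.
Proof.
move=> ltnk; rewrite /ballot.
have [m ->] : exists m, n%:Z - k%:Z = Negz m by exists (k - n).-1; lia.
have [l ->] : exists l, Negz m - 2 = Negz l by exists m.+2; lia.
by rewrite subrr.
Qed.

(** The symmetry of row 2n makes the recurrence valid at the boundary k = 0. *)
Lemma ballotN1 n : ballot n (-1) = 0.
Proof.
rewrite /ballot; case: n => [|n]; first by rewrite /= subrr.
have -> : n.+1%:Z - -1 = n.+2 by lia.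
have -> : n.+2%:Z - 2 = n by lia.
rewrite /= -(@bin_sub (2 * n.+1) n); last by lia.
have -> : (2 * n.+1 - n = n.+2)%N by lia.
by rewrite subrr.
Qed.

Variable U : lmodType K.
Implicit Type a : nat -> U.

Definition ballot_sum n a := \sum_(k < n.+1) ((-1) ^+ k * ballot n k) *: a k.

Lemma ballot_sum0 a : ballot_sum 0 a = a 0%N.
Proof.
by rewrite /ballot_sum big_ord1 /ballot /= subr0 mulr1 scale1r.
Qed.

(** Multiplication by 2 - T, transposed from the polynomial to the functional;
    the signs (-1)^k turn the plus signs of [ballotS] into those of 2 - T. *)
Lemma ballot_sumS n a :
  ballot_sum n.+1 a = ballot_sum n (fun k => a k *+ 2 - neighbours a k).
Proof.
pose prev k := if k is k'.+1 then a k' else 0.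
have -> : ballot_sum n (fun k => a k *+ 2 - neighbours a k)
  = ballot_sum n a *+ 2 - ballot_sum n (fun k => a k.+1) - ballot_sum n prev.
  rewrite /ballot_sum -sumrMnl -!sumrB; apply: eq_bigr => k _.
  by rewrite scalerBr -scalerMnr {1}/neighbours scalerDr opprD addrA.
rewrite {1}/ballot_sum.
transitivity (\sum_(k < n.+2)
  (((-1) ^+ k * ballot n k) *: a k *+ 2
    + ((-1) ^+ k * ballot n (k%:Z - 1)) *: a k
    + ((-1) ^+ k * ballot n (k%:Z + 1)) *: a k)).
  apply: eq_bigr => k _; rewrite ballotS mulrDr.
  rewrite [_ * (_ *+ 2 + _)]mulrDr mulrnAr.
  by rewrite 2!scalerDl scalerMnl.
rewrite 2!big_split sumrMnl /=; congr (_ *+ 2 + _ + _).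
- by rewrite big_ord_recr /= ballot_small // mulr0 scale0r addr0.
- rewrite big_ord_recl sub0r ballotN1 mulr0 scale0r add0r /ballot_sum -sumrN.
  apply: eq_bigr => k _; rewrite lift0 exprS.
  have -> : k.+1%:Z - 1 = k by lia.
  by rewrite mulN1r mulNr scaleNr.
rewrite !big_ord_recr /=.
have -> : n%:Z + 1 = n.+1 by lia.
have -> : n.+1%:Z + 1 = n.+2 by lia.
rewrite !ballot_small // !mulr0 !scale0r !addr0.
rewrite /ballot_sum big_ord_recl scaler0 add0r -sumrN; apply: eq_bigr => k _.
rewrite lift0 exprS mulN1r mulNr scaleNr opprK.
by have -> : k%:Z + 1 = k.+1 by lia.
Qed.

End Ballot.

(** * Comparison of the two functionals *)

Section Linearity.
Variables (K : fieldType) (q : K) (U U' : lmodType K).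

Lemma hermiteB (a b : nat -> U) n :
  hermite q (fun k => a k - b k) n = hermite q a n - hermite q b n.
Proof.
rewrite -qsumB; apply: eq_qsum => j _.
by case: (_ - _) => [k|[|k]] //=; rewrite ?subr0 // opprD.
Qed.

Lemma hermite_linear (f : {linear U -> U'}) (a : nat -> U) n :
  hermite q (fun k => f (a k)) n = f (hermite q a n).
Proof.
rewrite linear_sum; apply: eq_bigr => j _; rewrite linearZ /=; congr (_ *: _).
by case: (_ - _) => [k|[|k]] /=; rewrite ?linear0 ?linearN.
Qed.

Lemma eq_hermite (a b : nat -> U) n : a =1 b -> hermite q a n = hermite q b n.
Proof.
move=> ab; apply: eq_qsum => j _.
by case: (_ - _) => [k|[|k]] /=; rewrite ?ab.
Qed.
End Linearity.

Section MomentRecurrence.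
Variables (K : fieldType) (q : K).
Hypothesis q_neq0 : q != 0.

(** The formal rule <W'| (2 - T) p(T) |V> = (1 - q) <W| p(T) |V> for p = H_n.
    With h n = sum_s [n, s] q^s and g n = sum_s [n, s], it follows from
    h (n+1) = h n + q^(n+1) g n and
    (1 - q^(n+1)) h n = h (n+1) - q^(n+1) g (n+1), both obtained after reversing
    the sum h. *)
Lemma hermite_moment_neighbours n :
  hermite q (moment q) n *+ 2 - hermite q (neighbours (moment q)) n
  = (1 - q) *: (q ^+ n *: qsum q n (fun=> 1 : K^o)).
Proof.
pose g m : K^o := qsum q m (fun=> 1).
pose h m : K^o := qsum q m (fun s => q ^+ s : K^o).
have h_rev m : h m = qsum q m (fun s => q ^+ (m - s) : K^o) by exact: qsum_rev.
have h_up m : h m.+1 = h m + q ^+ m.+1 *: g m.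
  rewrite !h_rev qsum_pascal -qsumZ -qsumD; apply: eq_qsum => j lejm.
  rewrite subSS; congr (_ + _).
  by rewrite -[LHS]exprD -[RHS]/(_ * _) mulr1; congr (_ ^+ _); lia.
have h_down m : (1 - q ^+ m.+1) *: h m = h m.+1 - q ^+ m.+1 *: g m.+1.
  rewrite !h_rev [LHS](qsum_absorb q m (fun j => q ^+ (m.+1 - j) : K^o)).
  rewrite -qsumZ -qsumB; apply: eq_qsum => j lejm.
  rewrite scalerBl scale1r; congr (_ - _).
  by rewrite -[LHS]exprD -[RHS]/(_ * _) mulr1 subnKC.
rewrite !hermite_moment // -/(h n) -/(g n).
case: n => [|n].
  rewrite hermite0 /h /g !qsum0 /neighbours /moment !big_ord_recl !big_ord0 /=.
  change (1 *+ 2 - (1 + (q + 0) + 0) = (1 - q) * (1 * 1) :> K).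
  by ring.
rewrite -hermite_rec !hermite_moment // -/(h n) -/(h n.+2) h_down (h_up n.+1).
move: (h n.+1) (g n.+1) => x y.
change (x *+ 2 - (x + q ^+ n.+2 * y + (x - q ^+ n.+1 * y))
  = (1 - q) * (q ^+ n.+1 * y) :> K).
by rewrite (exprS q n.+1); ring.
Qed.

End MomentRecurrence.

(** * The q-oscillator and its Chebyshev vectors *)

Section Operators.
Variables (K : fieldType) (q : K) (U : lmodType K).
Variables (d e : {linear U -> U}) (W : {scalar U}) (V : U).
Hypothesis q_neq0 : q != 0.
Hypothesis de_comm : forall x, d (e x) = q *: e (d x) + (1 - q) *: x.
Hypothesis dV : d V = q *: V.
Hypothesis We : forall x, W (e x) = q * W x.
Hypothesis WV : W V = 1.

Let T : {linear U -> U} := (d \+ e).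

Fixpoint chebyshev (k : nat) : U :=
  match k with
  | 0 => V
  | k1.+1 => T (chebyshev k1) - (if k1 is k2.+1 then chebyshev k2 else 0)
  end.

Lemma neighbours_chebyshev k : neighbours chebyshev k = T (chebyshev k).
Proof. by rewrite /neighbours /= subrK. Qed.

(** Each time d crosses an e, the commutation relation adds a multiple of
    e^(j-1); these multiples sum to (1 - q) (1 + q + ... + q^(j-1)).  For j = 0
    the coefficient 1 - q^0 absorbs the default value 0.-1 = 0. *)
Lemma d_iter_e j :
  d (iter j e V) = q ^+ j.+1 *: iter j e V + (1 - q ^+ j) *: iter j.-1 e V.
Proof.
elim: j => [|j IHj]; first by rewrite /= dV subrr scale0r addr0.
rewrite iterS de_comm IHj linearD !linearZ /=.
have -> : (1 - q ^+ j) *: e (iter j.-1 e V) = (1 - q ^+ j) *: iter j e V.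
  by case: j {IHj} => [|j] //; rewrite subrr !scale0r.
rewrite scalerDr !scalerA -exprS -addrA -scalerDl; congr (_ + _ *: _).
by rewrite exprS; ring.
Qed.

(** The normally ordered form of H_n(T), with every d already evaluated on V:
    both sides satisfy the q-Hermite recurrence. *)
Lemma hermite_chebyshev n :
  hermite q chebyshev n = qsum q n (fun j => q ^+ (n - j) *: iter j e V).
Proof.
elim/ltn_ind: n => -[|[|n]] IHn.
- by rewrite hermite0 qsum0 scale1r.
- rewrite hermite1 qsum_pascal qsum0 /= subr0 dV expr0 !scale1r.
  by rewrite addrC.
apply: (addIr ((1 - q ^+ n.+1) *: hermite q chebyshev n)).
rewrite hermite_rec (eq_hermite q _ neighbours_chebyshev) hermite_linear.
rewrite !IHn // linear_sum.
transitivity (qsum q n.+1 (fun j =>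
  (q ^+ (n.+1 - j) *: iter j.+1 e V + q ^+ j *: (q ^+ (n.+2 - j) *: iter j e V))
  + (1 - q ^+ j) *: (q ^+ (n.+1 - j) *: iter j.-1 e V))).
  apply: eq_bigr => j _; rewrite linearZ /=; congr (_ *: _).
  rewrite !linearZ /= d_iter_e scalerDr addrC addrA; congr (_ + _ + _).
  rewrite !scalerA -!exprD; congr (_ ^+ _ *: _).
  by have := ltn_ord j; lia.
by rewrite qsumD -qsum_absorb [qsum q n.+2 _]qsum_pascal.
Qed.

(** Both sides have the same q-Hermite transform. *)
Lemma W_chebyshev k :
  (1 - q) * W (chebyshev k) = moment q k *+ 2 - neighbours (moment q) k.
Proof.
pose Wo : {linear U -> K^o} := W.
have We_iter j : W (iter j e V) = q ^+ j.
  by elim: j => [|j IHj] //=; rewrite We IHj exprS.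
apply/eqP; rewrite -subr_eq0; apply/eqP.
pose a k : K^o := (1 - q) *: Wo (chebyshev k).
pose b k : K^o := moment q k *+ 2 - neighbours (moment q) k.
apply: (hermite_eq0 (q := q) (a := fun k => a k - b k)) => n.
rewrite hermiteB.
have -> : hermite q a n = (1 - q) *: (q ^+ n *: qsum q n (fun=> 1 : K^o)).
  rewrite (hermite_linear q ((1 - q) \*: Wo)) hermite_chebyshev /= linear_sum.
  congr (_ *: _); rewrite -qsumZ; apply: eq_bigr => j _.
  rewrite linearZ /= linearZ /= We_iter; congr (_ *: _).
  by rewrite -[LHS]exprD -[RHS]/(_ * _) mulr1 subnK // -ltnS.
have -> : hermite q b n
    = hermite q (moment q) n *+ 2 - hermite q (neighbours (moment q)) n.
  rewrite hermiteB; congr (_ - _).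
  exact: (hermite_linear q ((idfun : {linear K^o -> K^o}) \+ idfun)).
by rewrite hermite_moment_neighbours // subrr.
Qed.

Lemma iter_chebyshev n :
  iter n (fun x => x *+ 2 - T x) V = ballot_sum n chebyshev.
Proof.
elim: n => [|n IHn]; first by rewrite ballot_sum0.
rewrite iterS IHn ballot_sumS /ballot_sum linear_sum -sumrMnl -sumrB.
apply: eq_bigr => k _; rewrite neighbours_chebyshev linearZ /=.
by rewrite scalerBr scalerMnr.
Qed.

(** By [W_chebyshev], the factor 1 - q supplies one more application of 2 - T,
    which [ballot_sumS] absorbs into the index. *)
Lemma W_iter n :
  (1 - q) * W (iter n (fun x => x *+ 2 - T x) V) = ballot_sum n.+1 (moment q).
Proof.
rewrite iter_chebyshev ballot_sumS linear_sum mulr_sumr.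
by apply: eq_bigr => k _; rewrite linearZ /= mulrCA W_chebyshev.
Qed.

End Operators.

(** * The theorem *)

Theorem corollary1 (F : fieldType) (iota : {rmorphism Qq -> F})
    (q : F) (Hq : q = iota Qq_var)
    (U : lmodType F) (D E : {linear U -> U}) (W : {scalar U}) (V : U)
    (HDE : forall x : U, D (E x) - q *: E (D x) = D x + E x)
    (HWE : forall x : U, W (E x) = W x)
    (HDV : D V = V)
    (HWV : W V = 1)
    (n : nat) (Hn : (0 < n)%N) :
  W (iter n.-1 (fun x : U => D x + E x) V) =
  1 / (1 - q) ^+ n *
  \sum_(0 <= k < n.+1)
     (-1) ^+ k *
     ((binz (2 * n) (n%:Z - k%:Z))%:R - (binz (2 * n) (n%:Z - k%:Z - 2))%:R) *
     \sum_(0 <= i < k.+1) q ^+ (i * (k + 1 - i)).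
Proof.
have q_neq0 : q != 0 by rewrite Hq fmorph_eq0 tofrac_eq0 polyX_eq0.
have q_neq1 : 1 - q != 0.
  rewrite subr_eq0 Hq -(rmorph1 iota) (inj_eq (fmorph_inj iota)) -tofrac1.
  rewrite tofrac_eq; apply/eqP => X1.
  by have := size_poly1 rat; rewrite X1 size_polyX.
pose d : {linear U -> U} := idfun \- (1 - q) \*: D.
pose e : {linear U -> U} := idfun \- (1 - q) \*: E.
have de_comm x : d (e x) = q *: e (d x) + (1 - q) *: x.
  rewrite /d /e /= !linearB !linearZ /=.
  have -> : D (E x) = q *: E (D x) + (D x + E x) by rewrite -HDE addrC subrK.
  move: (D x) (E x) (E (D x)) => dx ex edx.
  (* Once q is written as 1 - (1 - q) in front of every vector that carries a
     factor 1 - q, both sides are integer combinations of the same vectors. *)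
  have qscale v : q *: ((1 - q) *: v)
      = (1 - q) *: v - (1 - q) *: ((1 - q) *: v).
    by rewrite -{2}[(1 - q) *: v]scale1r -scalerBl subKr.
  rewrite !(scalerN, opprK, scalerDr) !qscale !opprB.
  have -> : (1 - q) *: ((1 - q) *: (q *: edx))
    = (1 - q) *: ((1 - q) *: edx) - (1 - q) *: ((1 - q) *: ((1 - q) *: edx)).
    by rewrite -!scalerBr -{2}[edx]scale1r -scalerBl subKr.
  rewrite !addrA [RHS](ACl (1 * 8 * 5 * 3 * 6 * 7 * 2 * 4)).
  by rewrite /= -scalerDl [q + _]addrC subrK scale1r.
have dV : d V = q *: V.
  by rewrite /d /= HDV -{1}[V]scale1r -scalerBl subKr.
have We x : W (e x) = q * W x.
  by rewrite /e /= linearB linearZ /= HWE; ring.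
case: n Hn => // n _ /=.
have iterE m : iter m (fun x => x *+ 2 - (d x + e x)) V
    = (1 - q) ^+ m *: iter m (fun x => D x + E x) V.
  elim: m => [|m IHm]; first by rewrite scale1r.
  rewrite !iterS IHm; set x := iter _ _ _; rewrite /d /e /= !linearZ /=.
  have collect (u v w : U) : u *+ 2 - (u - v + (u - w)) = v + w.
    by rewrite addrACA -opprD -mulr2n opprB addrC subrK.
  by rewrite !scalerN !scalerA -!exprS collect scalerDr.
have := W_iter q_neq0 de_comm dV We HWV n.
rewrite /= iterE linearZ /= mulrA -exprS => H.
apply: (mulfI (expf_neq0 n.+1 q_neq1)).
rewrite {}H mulrA mul1r divff ?expf_neq0 // mul1r big_mkord.
by apply: eq_bigr => k _; rewrite big_mkord.
Qed.
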